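(* For every even integer $d$ and every bipartite graph $G=(A\cup B,E)$ with $n$ vertices, the $d$-Scattered Set problem can be approximated within a factor of $2\sqrt{n}$ in polynomial time; that is, there is a polynomial-time algorithm that outputs a $d$-scattered set of $G$ of size at least $OPT_d(G)/(2\sqrt{n})$.
   Context: All graphs are finite, simple and undirected. $d_G(u,v)$ is the shortest-path distance (number of edges) between $u$ and $v$ in $G$. A $d$-scattered set of $G$ is a set $K\subseteq V(G)$ with $d_G(u,v)\ge d$ for all distinct $u,v\in K$; $OPT_d(G)$ is the maximum size of a $d$-scattered set in $G$. *)

(* Defs.v *)
From HB Require Import structures.
From mathcomp Require Import all_boot all_order all_algebra.

Set Implicit Arguments.
Unset Strict Implicit.
Unset Printing Implicit Defensive.

Section Graphs.

Variables (T : finType) (e : rel T).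

Definition simple_graph : Prop := symmetric e /\ irreflexive e.

Definition bipartition (A B : {set T}) : Prop :=
  [/\ A :|: B = [set: T], [disjoint A & B] &
      forall u v, e u v ->
        (u \in A) && (v \in B) || (u \in B) && (v \in A)].

Definition has_walk (u v : T) (k : nat) : bool :=
  [exists p : k.-tuple T, path e u p && (last u p == v)].

Lemma connect_has_walk u v : connect e u v -> exists k, has_walk u v k.
Proof.
case/connectP=> p ep ->; exists (size p); apply/existsP.
by exists (in_tuple p); rewrite /= ep eqxx.
Qed.

(* None stands for infinite distance (distinct connected components). *)
Definition dist (u v : T) : option nat :=
  match @idP (connect e u v) with
  | ReflectT uv => Some (ex_minn (connect_has_walk uv))
  | ReflectF _ => None
  end.

Definition dist_ge (d : nat) (u v : T) : bool :=
  if dist u v is Some k then d <= k else true.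

Definition scattered (d : nat) (K : {set T}) : bool :=
  [forall u in K, forall v in K, (u != v) ==> dist_ge d u v].

Definition OPT (d : nat) : nat := \max_(K : {set T} | scattered d K) #|K|.

End Graphs.

(* Model of computation: a structured random access machine.  The store      *)
(* consists of infinitely many arrays of natural numbers, of which a program *)
(* mentions finitely many; array names occur literally in programs, while    *)
(* cell indices are computed.  The only arithmetic is addition and truncated *)
(* subtraction, so that t steps lengthen the binary expansion of the largest *)
(* value by O(t) bits; hence unit cost time is polynomially related to       *)
(* Turing machine time.                                                      *)
Definition store := nat -> nat -> nat.

Inductive expr :=
  | Cst of nat
  | Get of nat & expr
  | Add of expr & expr
  | Sub of expr & expr.

Inductive cmd :=
  | Skip
  | Set_ of nat & expr & expr
  | Seq of cmd & cmd
  | If of expr & cmd & cmd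
  | While of expr & cmd.

Fixpoint eval (m : store) (x : expr) : nat :=
  match x with
  | Cst k => k
  | Get a i => m a (eval m i)
  | Add x1 x2 => eval m x1 + eval m x2
  | Sub x1 x2 => eval m x1 - eval m x2
  end.

Definition update (m : store) (a i v : nat) : store :=
  fun a' i' => if (a' == a) && (i' == i) then v else m a' i'.

(* exec c m t m' : started in m, the program c halts in m' after t steps.    *)
(* Tests succeed on nonzero values.  Evaluating an expression is one step:   *)
(* the expressions of a fixed program have bounded size.                     *)
Inductive exec : cmd -> store -> nat -> store -> Prop :=
  | ExecSkip m : exec Skip m 1 m
  | ExecSet a i x m :
      exec (Set_ a i x) m 1 (update m a (eval m i) (eval m x))
  | ExecSeq c1 c2 m1 m2 m3 t1 t2 :
      exec c1 m1 t1 m2 -> exec c2 m2 t2 m3 ->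
      exec (Seq c1 c2) m1 (t1 + t2) m3
  | ExecIfT x c1 c2 m m' t :
      eval m x != 0 -> exec c1 m t m' -> exec (If x c1 c2) m t.+1 m'
  | ExecIfF x c1 c2 m m' t :
      eval m x = 0 -> exec c2 m t m' -> exec (If x c1 c2) m t.+1 m'
  | ExecWhileT x c m1 m2 m3 t1 t2 :
      eval m1 x != 0 -> exec c m1 t1 m2 -> exec (While x c) m2 t2 m3 ->
      exec (While x c) m1 (t1 + t2).+1 m3
  | ExecWhileF x c m : eval m x = 0 -> exec (While x c) m 1 m.

Lemma exec_det c m t m1 t' m2 :
  exec c m t m1 -> exec c m t' m2 -> t = t' /\ m1 = m2.
Proof.
move=> E; elim: E t' m2 => {c m t m1}; intros;
  match goal with E : exec _ _ ?t ?m |- _ = ?t /\ _ = ?m =>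
    inversion E; subst end;
  repeat match goal with
    IH : forall t m, exec ?c ?m0 t m -> _, H : exec ?c ?m0 _ _ |- _ =>
      case: (IH _ _ H) => ? ?; subst; clear IH end;
  by [ | congruence | match goal with
    nz : is_true (?x != 0), z : ?x = 0 |- _ => by rewrite z in nz end].
Qed.

(* The input word is stored in array 0; all other cells are 0. *)
Definition init (s : seq nat) : store :=
  fun a i => if a == 0 then nth 0 s i else 0.

(* Total length of the binary expansions of the entries (0 has length 1). *)
Definition bitsize (s : seq nat) : nat := \sum_(w <- s) (trunc_log 2 w).+1.

(* Number of vertices, distance parameter, row-major adjacency matrix. *)
Definition encode (n : nat) (e : rel 'I_n) (d : nat) : seq nat :=
  n :: d :: [seq nat_of_bool (e u v) | u <- enum 'I_n, v <- enum 'I_n].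

(* The output set is given by its characteristic vector, in array 1. *)
Definition output (n : nat) (m : store) : {set 'I_n} :=
  [set v : 'I_n | m 1 v != 0].

(* Main.v *)
Require Import Defs.
From HB Require Import structures.
From mathcomp Require Import all_boot all_order all_algebra.
From mathcomp Require Import zify.
(* Without this, Sub would denote the subType constructor of eqtype. *)
Import Defs.
Import Order.TTheory GRing.Theory Num.Theory.

Set Implicit Arguments.
Unset Strict Implicit.
Unset Printing Implicit Defensive.

(* In a bipartite graph two connected vertices on the same side are at even  *)
(* distance, so for even d they are at distance at least d exactly when their *)
(* balls of radius (d-2)/2 are disjoint.  On one side the problem is thus a   *)
(* set packing problem, which the greedy algorithm taking the smallest balls  *)
(* first solves within a factor sqrt n: if the optimum O is charged to the    *)
(* greedy solution K, with o_v members of O charged to v, then                *)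
(*   |O|^2 = (sum_v o_v)^2 <= |K| sum_v o_v^2                                 *)
(*         <= |K| sum_(w in O) |ball w| <= |K| n.                             *)
(* The better of the two sides costs another factor 2.  The sides are not     *)
(* part of the input; they are replaced by the parity of the distance to a    *)
(* fixed vertex of each component.                                            *)

(** * Bounded loop programs *)

(** Call two vertices in conflict when their distance is even and below [d]. In a bipartite graph
    connected vertices have equal colour exactly when their distance is even, so one greedy pass
    over all vertices serves both sides: the chosen vertices of one colour are [d]-scattered
    ([scattered_class]), and a vertex of an optimum is charged to a chosen vertex of its own colour
    whose ball is no larger and meets its ball, at the midpoint of a shortest walk ([cball_meet]).
    Balls around an optimum are disjoint ([cball_disjoint]), so [packing_charge] bounds the squares
    of the two colour parts a and b of the optimum by kn, where k is the size of the larger chosen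
    class; then (a+b)^2 <= 2(a^2+b^2) <= 4nk <= 4nk^2 ([OPT_bound]).

    For the running time, the algorithm is written in a language whose loops all make n rounds.
    Programs denote total functions on stores ([den]), their compiled runs take time polynomial in n
    ([compile_exec]), and n is at most the input size ([leq_bitsize_encode]). Correctness is proved
    about [den] with loop invariants ([den_for]) and collected in [den_main]. *)

Inductive prog :=
  | PSkip
  | PSet of nat & expr & expr
  | PSeq of prog & prog
  | PIf of expr & prog & prog
  | PFor of nat & prog.

Fixpoint compile (p : prog) : cmd :=
  match p with
  | PSkip => Skip
  | PSet a i x => Set_ a i x
  | PSeq p1 p2 => Seq (compile p1) (compile p2)
  | PIf x p1 p2 => If x (compile p1) (compile p2)
  | PFor x p =>
      Seq (Set_ x (Cst 0) (Cst 0))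
        (While (Sub (Get 0 (Cst 0)) (Get x (Cst 0)))
          (Seq (compile p) (Set_ x (Cst 0) (Add (Get x (Cst 0)) (Cst 1)))))
  end.

(** A total function, possible because the number of rounds of a loop is fixed on entry; correctness
    proofs rewrite with it and never invert [exec]. *)
Fixpoint den (p : prog) (m : store) : store :=
  match p with
  | PSkip => m
  | PSet a i x => update m a (eval m i) (eval m x)
  | PSeq p1 p2 => den p2 (den p1 m)
  | PIf x p1 p2 => if eval m x != 0 then den p1 m else den p2 m
  | PFor x p =>
      iter (m 0 0) (fun m1 => let m2 := den p m1 in update m2 x 0 (m2 x 0 + 1))
        (update m x 0 0)
  end.
Arguments den : simpl never.

Fixpoint writes (p : prog) : seq nat :=
  match p with
  | PSkip => [::]
  | PSet a _ _ => [:: a]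
  | PSeq p1 p2 => writes p1 ++ writes p2
  | PIf _ p1 p2 => writes p1 ++ writes p2
  | PFor x p => x :: writes p
  end.

(* The number of vertices, kept in cell 0 of array 0, bounds every loop. *)
Fixpoint wf (p : prog) : bool :=
  match p with
  | PSkip => true
  | PSet a _ _ => a != 0
  | PSeq p1 p2 => wf p1 && wf p2
  | PIf _ p1 p2 => wf p1 && wf p2
  | PFor x p => [&& x != 0, x \notin writes p & wf p]
  end.

(** A conditional is charged for both branches. In a loop, each round pays 2 for the test and the
    increment, and the final 2 pays for the initialisation and the failing last test. *)
Fixpoint cost (p : prog) : {poly nat} :=
  (match p with
  | PSkip => 1
  | PSet _ _ _ => 1
  | PSeq p1 p2 => cost p1 + cost p2
  | PIf _ p1 p2 => cost p1 + cost p2 + 1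
  | PFor _ p => 'X * (cost p + 2%N%:P) + 2%N%:P
  end)%R.

Lemma wf_writes0 p : wf p -> 0 \notin writes p.
Proof.
elim: p => //= [a _ _|p IHp q IHq|_ p IHp q IHq|x p IHp].
- by rewrite inE eq_sym.
- by case/andP=> /IHp p0 /IHq q0; rewrite mem_cat negb_or p0.
- by case/andP=> /IHp p0 /IHq q0; rewrite mem_cat negb_or p0.
- by case/and3P=> x0 _ /IHp p0; rewrite inE negb_or eq_sym x0.
Qed.

Lemma update_neq m x i v a : a != x -> update m x i v a =1 m a.
Proof. by move=> /negPf ax j; rewrite /update ax. Qed.

Lemma den_frame p a m : a \notin writes p -> den p m a =1 m a.
Proof.
elim: p m => [|b i x|p IHp q IHq|x p IHp q IHq|x p IHp] m //=.
- by rewrite inE; apply: update_neq.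
- by rewrite mem_cat => /norP[ap aq] j; rewrite /den -/den IHq ?IHp.
- rewrite mem_cat => /norP[ap aq] j; rewrite /den -/den.
  by case: ifP => _; rewrite ?IHq ?IHp.
- rewrite inE => /norP[ax ap] j; rewrite /den -/den.
  by elim: (m 0 0) => [|k IHk]; rewrite /= update_neq ?IHp.
Qed.

(** By [wf] no loop body touches its own counter or the bound in cell 0 of array 0, so every loop
    makes exactly [m 0 0] rounds. The bound holds for every larger [N], so that the input size can
    be substituted for n. *)
Lemma compile_exec p m N : wf p -> m 0 0 <= N ->
  exists2 t, exec (compile p) m t (den p m) & t <= (cost p).[N]%R.
Proof.
elim: p m => [|a i x|p IHp q IHq|x p IHp q IHq|x p IHp] m /=.
- by exists 1; [constructor | rewrite hornerE].
- by exists 1; [constructor | rewrite hornerE].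
- case/andP=> wp wq le_mN.
  have [t1 E1 le1] := IHp m wp le_mN.
  have [|t2 E2 le2] := IHq (den p m) wq; first by rewrite den_frame ?wf_writes0.
  exists (t1 + t2); first by econstructor; eauto.
  by rewrite hornerD leq_add.
- case/andP=> wp wq le_mN.
  have [t1 E1 le1] := IHp m wp le_mN.
  have [t2 E2 le2] := IHq m wq le_mN.
  rewrite !hornerE /den -/den; case: ifP => [x0|/negbFE/eqP x0].
    by exists t1.+1; [constructor | rewrite !(natrDE, natrME); lia].
  by exists t2.+1; [constructor | rewrite !(natrDE, natrME); lia].
- case/and3P=> x0 xp wp le_mN.
  pose F m1 := let m2 := den p m1 in update m2 x 0 (m2 x 0 + 1).
  (* Here [k] counts the rounds still to come. *)
  have W k m1 : m1 x 0 + k = m1 0 0 -> m1 0 0 <= N ->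
    exists2 t, exec (While (Sub (Get 0 (Cst 0)) (Get x (Cst 0)))
      (Seq (compile p) (Set_ x (Cst 0) (Add (Get x (Cst 0)) (Cst 1)))))
      m1 t (iter k F m1) & t <= k * ((cost p).[N]%R + 2) + 1.
    elim: k m1 => [|k IHk] m1 m1k le_m1N.
      by exists 1; first by apply: ExecWhileF => /=; lia.
    have [t1 E1 le1] := IHp m1 wp le_m1N.
    have F0 : F m1 0 0 = m1 0 0.
      by rewrite /F /= update_neq 1?eq_sym // den_frame ?wf_writes0.
    have Fx : F m1 x 0 = m1 x 0 + 1.
      by rewrite /F /= /update !eqxx /= den_frame.
    have [||t2 E2 le2] := IHk (F m1); [lia | lia |].
    exists (t1 + 1 + t2).+1; last by lia.
    rewrite iterSr; apply: ExecWhileT E2; first by rewrite /=; lia.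
    by econstructor; [exact: E1 | constructor].
  have U0 : update m x 0 0 0 0 = m 0 0 by rewrite update_neq // eq_sym.
  have [||t E le] := W (m 0 0) (update m x 0 0); rewrite ?U0 //.
    by rewrite /update !eqxx.
  exists (1 + t); first by econstructor; [constructor | exact: E].
  rewrite !(hornerD, hornerM, hornerX, hornerC) !(natrDE, natrME).
  have := leq_mul2r ((cost p).[N]%R + 2) (m 0 0) N; rewrite le_mN orbT.
  rewrite -[X in _ <= _ + X]/2 => leN.
  by rewrite add1n addn2 ltnS (leq_trans le) // addn1 ltnS.
Qed.

(** The loop rule. It supplies the counter value and the unchanged arrays itself, so an invariant
    need only describe the arrays that the body writes. *)
Lemma den_for n x p (m : store) (Inv : nat -> store -> Prop) :
  m 0 0 = n -> wf (PFor x p) -> Inv 0 (update m x 0 0) ->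
  (forall (i : 'I_n) (m1 : store), m1 x 0 = i ->
     (forall a, a \notin x :: writes p -> m1 a =1 m a) ->
     Inv i m1 -> Inv i.+1 (update (den p m1) x 0 i.+1)) ->
  Inv n (den (PFor x p) m).
Proof.
move=> mn /and3P[x0 xp wp] I0 IS; rewrite /den -/den mn.
set F := fun m1 => _.
suff W k : k <= n -> [/\ iter k F (update m x 0 0) x 0 = k,
    forall a, a \notin x :: writes p -> iter k F (update m x 0 0) a =1 m a
    & Inv k (iter k F (update m x 0 0))] by have [] := W n (leqnn n).
elim: k => [|k IHk] lekn /=.
  by split=> // [|a]; [rewrite /update !eqxx | rewrite inE => /norP[ax _]; apply: update_neq].
have [Ek fk Ik] := IHk (ltnW lekn).
have Exk : den p (iter k F (update m x 0 0)) x 0 + 1 = k.+1 by rewrite den_frame // Ek addn1.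
split.
- by rewrite /F /= Exk /update !eqxx.
- move=> a H j; move: (H); rewrite inE => /norP[ax ap].
  by rewrite /F /= update_neq // den_frame ?fk.
- by rewrite /F /= Exk; apply: (IS (Ordinal lekn)).
Qed.

(** Truth is being nonzero, and truncated subtraction provides the connectives: 1 - x is nonzero
    only at x = 0, and x - y vanishes exactly when x <= y. *)
Definition Not x := Sub (Cst 1) x.
Definition And x y := Not (Add (Not x) (Not y)).
Definition Eq x y := Not (Add (Sub x y) (Sub y x)).
Definition Le x y := Not (Sub x y).

Lemma nz_Not m x : (eval m (Not x) != 0) = (eval m x == 0).
Proof. by rewrite /=; lia. Qed.
Lemma nz_And m x y :
  (eval m (And x y) != 0) = (eval m x != 0) && (eval m y != 0).
Proof. by rewrite /=; lia. Qed.
Lemma nz_Eq m x y : (eval m (Eq x y) != 0) = (eval m x == eval m y).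
Proof. by rewrite /=; lia. Qed.
Lemma nz_Le m x y : (eval m (Le x y) != 0) = (eval m x <= eval m y).
Proof. by rewrite /=; lia. Qed.
Definition nzE := (nz_And, nz_Eq, nz_Le, nz_Not).

Lemma den_seq p q m : den (PSeq p q) m = den q (den p m).
Proof. by []. Qed.
Lemma den_set a i x m : den (PSet a i x) m = update m a (eval m i) (eval m x).
Proof. by []. Qed.
Lemma den_if x p q m :
  den (PIf x p q) m = if eval m x != 0 then den p m else den q m.
Proof. by []. Qed.
Lemma den_skip m : den PSkip m = m. Proof. by []. Qed.

(** * Walks, distances and balls *)

Section Walks.

Variables (T : finType) (e : rel T).

Lemma has_walkP u v k :
  reflect (exists p, [/\ size p = k, path e u p & last u p = v])
          (has_walk e u v k).
Proof.
apply: (iffP existsP) => [[p /andP[ep /eqP pv]]|[p [sp ep pv]]].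
  by exists p; rewrite size_tuple.
have sp' : size p == k by apply/eqP.
by exists (Tuple sp'); rewrite /= ep pv eqxx.
Qed.

Lemma has_walk0 u v : has_walk e u v 0 = (u == v).
Proof.
apply/has_walkP/eqP => [[p [/size0nil -> _ <-]]|->] //.
by exists [::].
Qed.

Lemma has_walkS u v k :
  has_walk e u v k.+1 = [exists w, has_walk e u w k && e w v].
Proof.
apply/has_walkP/existsP => [[p []]|[w /andP[/has_walkP[p [sp ep pw]] ewv]]].
  case/lastP: p => // p x; rewrite size_rcons rcons_path last_rcons.
  move=> [sp] /andP[ep epx] <-; exists (last u p); rewrite epx andbT.
  by apply/has_walkP; exists p.
exists (rcons p v); split; first by rewrite size_rcons sp.
  by rewrite rcons_path ep pw.
by rewrite last_rcons.
Qed.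

Lemma has_walk_cat u v w k l :
  has_walk e u v k -> has_walk e v w l -> has_walk e u w (k + l).
Proof.
move=> /has_walkP[p [<- ep <-]] /has_walkP[q [<- eq <-]]; apply/has_walkP.
by exists (p ++ q); rewrite size_cat cat_path ep last_cat.
Qed.

Lemma has_walk_split u v k l :
  has_walk e u v (k + l) -> exists2 w, has_walk e u w k & has_walk e w v l.
Proof.
elim: l v => [|l IHl] v; first by rewrite addn0; exists v; rewrite ?has_walk0.
rewrite addnS has_walkS => /existsP[w /andP[/IHl[x ux xw] wv]].
by exists x => //; rewrite has_walkS; apply/existsP; exists w; rewrite xw.
Qed.

Lemma has_walk_sym u v k : symmetric e -> has_walk e u v k -> has_walk e v u k.
Proof.
move=> sym_e; elim: k v => [|k IHk] v; first by rewrite !has_walk0 eq_sym.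
rewrite has_walkS => /existsP[w /andP[/IHk wu wv]].
apply: (@has_walk_cat v w u 1) => //.
by rewrite has_walkS; apply/existsP; exists v; rewrite has_walk0 eqxx sym_e.
Qed.

Lemma has_walk_connect u v k : has_walk e u v k -> connect e u v.
Proof. by case/has_walkP=> p [_ ep pv]; apply/connectP; exists p. Qed.

(** Replaces the dependent match in [dist] by minimality among walk lengths. *)
Lemma dist_spec u v k :
  dist e u v = Some k <->
  has_walk e u v k /\ forall j, has_walk e u v j -> k <= j.
Proof.
rewrite /dist; case: {-}_ / (@idP (connect e u v)) => [uv|nuv].
  case: ex_minnP => j uvj minj; split=> [[<-]|[uvk mink]] //.
  by congr Some; apply/eqP; rewrite eqn_leq minj ?mink.
by split=> // -[/has_walk_connect].
Qed.

Lemma has_walk_dist u v k :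
  has_walk e u v k -> exists2 j, dist e u v = Some j & j <= k.
Proof.
move=> uvk; have ex : exists k, has_walk e u v k by exists k.
case: (ex_minnP ex) => j uvj minj; exists j; last exact: minj.
by apply/dist_spec.
Qed.

Lemma dist_walk u v k : dist e u v = Some k -> has_walk e u v k.
Proof. by case/dist_spec. Qed.

Lemma dist_min u v k j : dist e u v = Some k -> has_walk e u v j -> k <= j.
Proof. by case/dist_spec=> _; apply. Qed.

Lemma dist_eq0 u v : (dist e u v == Some 0) = (u == v).
Proof.
apply/eqP/eqP => [/dist_walk|->]; first by rewrite has_walk0 => /eqP.
by apply/dist_spec; rewrite has_walk0.
Qed.

Lemma dist_pred u v k : dist e u v = Some k.+1 ->
  exists2 w, dist e u w = Some k & e w v.
Proof.
move=> uv; have := dist_walk uv; rewrite has_walkS => /existsP[w /andP[uw wv]].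
exists w => //; have [j uwj lejk] := has_walk_dist uw.
suff: k <= j by move=> lekj; rewrite uwj; congr Some; apply/eqP; rewrite eqn_leq lejk.
rewrite -ltnS; apply: dist_min uv _; rewrite has_walkS; apply/existsP; exists w.
by rewrite (dist_walk uwj).
Qed.

Lemma dist_succ u v w k : dist e u w = Some k -> e w v ->
  exists2 j, dist e u v = Some j & j <= k.+1.
Proof.
move=> uw wv; apply: has_walk_dist; rewrite has_walkS; apply/existsP.
by exists w; rewrite (dist_walk uw).
Qed.

(** A walk shortens to one without repeated vertices. Hence n rounds of the distance computation
    suffice. *)
Lemma dist_lt_card u v k : dist e u v = Some k -> k < #|T|.
Proof.
move=> uv; have /has_walkP[p [sp ep pv]] := dist_walk uv.
move: pv; case/shortenP: ep => q eq uq _ qv.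
have le : k <= size q by apply: dist_min uv _; apply/has_walkP; exists q.
by apply: leq_ltn_trans le _; rewrite -[(size q).+1]/(size (u :: q)) -(card_uniqP uq) max_card.
Qed.

Lemma dist_connect u v : (dist e u v != None) = connect e u v.
Proof.
apply/idP/idP => [|/connect_has_walk[k /has_walk_dist[j -> _]]] //.
by case E: (dist e u v) => [k|] // _; apply: has_walk_connect (dist_walk E).
Qed.

(** Every edge changes sides. *)
Lemma walk_parity (A B : {set T}) u v k : bipartition e A B ->
  has_walk e u v k -> odd k = (u \in A) (+) (v \in A).
Proof.
case=> _ dAB eAB; elim: k v => [|k IHk] v.
  by rewrite has_walk0 => /eqP ->; rewrite addbb.
rewrite has_walkS => /existsP[w /andP[/IHk uw /eAB wv]].
rewrite /= uw; case/orP: wv => /andP[wA vA].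
  by rewrite wA (disjointFl dAB vA) !addbF addbT negbK.
by rewrite (disjointFl dAB wA) vA addbT addbF.
Qed.

Definition cball (r : nat) (u : T) : {set T} :=
  [set x | if dist e u x is Some j then j <= r else false].

Lemma cball_walk r u x k : has_walk e u x k -> k <= r -> x \in cball r u.
Proof.
by move=> /has_walk_dist[j uxj lejk] lekr; rewrite inE uxj (leq_trans lejk).
Qed.

(** The midpoint of the walk lies in both balls. *)
Lemma cball_meet u v k r : symmetric e -> has_walk e u v k.*2 -> k <= r ->
  cball r u :&: cball r v != set0.
Proof.
move=> sym_e; rewrite -addnn => /has_walk_split[w uw wv] lekr.
apply/set0Pn; exists w; rewrite inE !(cball_walk _ lekr) //.
exact: has_walk_sym.
Qed.

Lemma cball_disjoint d u v : symmetric e -> u != v -> dist_ge e d u v ->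
  [disjoint cball (d - 2)./2 u & cball (d - 2)./2 v].
Proof.
move=> sym_e uv dge; apply/pred0P => x /=; apply/negP; rewrite !inE.
case ux: (dist e u x) => [j|//]; case vx: (dist e v x) => [k|]; last by rewrite andbF.
move=> /andP[lej lek].
have [l uvl lel] := has_walk_dist
  (has_walk_cat (dist_walk ux) (has_walk_sym sym_e (dist_walk vx))).
move: dge; rewrite /dist_ge uvl => ledl.
(* For [d] at least 2 the bounds contradict each other, since l <= d - 2; for smaller [d] the radius
   is 0 and forces l = 0. *)
have l0 : l = 0 by lia.
by move: uv; rewrite -dist_eq0 uvl l0.
Qed.

End Walks.

(** * The charging inequality for set packings *)

(** Cauchy-Schwarz against the constant 1, obtained by summing 2ab <= a^2 + b^2 over all pairs. *)
Lemma sum_sqr_le (I : finType) (K : {set I}) (o : I -> nat) :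
  (\sum_(v in K) o v) ^ 2 <= #|K| * \sum_(v in K) o v ^ 2.
Proof.
have E : #|K| * \sum_(v in K) o v ^ 2 = \sum_(u in K) \sum_(v in K) o v ^ 2.
  by rewrite sum_nat_const.
rewrite -leq_double -!muln2 !(mulnC _ 2).
have -> : 2 * (\sum_(v in K) o v) ^ 2 = \sum_(u in K) \sum_(v in K) 2 * (o u * o v).
  rewrite expnS expn1 big_distrl big_distrr /=; apply: eq_bigr => u _.
  by rewrite !big_distrr.
have -> : 2 * (#|K| * \sum_(v in K) o v ^ 2) =
    \sum_(u in K) \sum_(v in K) (o u ^ 2 + o v ^ 2).
  rewrite mul2n -addnn {1}E exchange_big E -big_split; apply: eq_bigr => u _.
  by rewrite -big_split.
by apply: leq_sum => u _; apply: leq_sum => v _; apply: nat_Cauchy.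
Qed.

(* Each w in O is charged to f w in K.  At most #|S v| members of O are    *)
(* charged to v, because their sets are disjoint and meet S v, and each of *)
(* these sets has at least #|S v| elements.                                *)
Lemma packing_charge (T : finType) (S : T -> {set T}) (O K : {set T})
    (f : T -> T) :
  {in O &, forall u v, u != v -> [disjoint S u & S v]} ->
  {in O, forall w, [/\ f w \in K, S (f w) :&: S w != set0 & #|S (f w)| <= #|S w|]} ->
  #|O| ^ 2 <= #|K| * #|T|.
Proof.
move=> dO fO; pose o v := \sum_(w in O | f w == v) 1.
(* Double counting: a point of [U] lies in at most one of the disjoint sets. *)
have sum_disjoint (P : pred T) (U : {set T}) :
    (forall w, P w -> w \in O) -> \sum_(w | P w) #|U :&: S w| <= #|U|.
  move=> PO.
  have -> : \sum_(w | P w) #|U :&: S w| = \sum_(w | P w) \sum_(x in U) (x \in S w).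
    apply: eq_bigr => w _; rewrite -sum1_card [RHS](big_setID (S w)) /=.
    rewrite [X in _ = _ + X]big1 ?addn0; last by move=> x /setDP[_ /negPf ->].
    by apply: eq_bigr => x /setIP[_ ->].
  rewrite exchange_big -sum1_card /=; apply: leq_sum => x _.
  have [w /andP[Pw xw]|none] := pickP [pred w | P w && (x \in S w)].
    rewrite (bigD1 w) //= xw big1 // => v /andP[Pv vw].
    by rewrite (disjointFl (dO _ _ (PO _ Pv) (PO _ Pw) vw) xw).
  by rewrite big1 // => w Pw; have := none w; rewrite /= Pw /= => ->.
have le_o v : o v <= #|S v|.
  apply: leq_trans (sum_disjoint [pred w | (w \in O) && (f w == v)] (S v) _); last first.
    by move=> w /andP[].
  apply: leq_sum => w /andP[wO /eqP <-].
  by rewrite card_gt0; have [] := fO w wO.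
have EO : #|O| = \sum_(v in K) o v.
  rewrite -sum1_card (partition_big f (mem K)) //= => w wO.
  by have [] := fO w wO.
rewrite EO; apply: leq_trans (sum_sqr_le K o) _; rewrite leq_mul2l; apply/orP; right.
(* Exactly [o v] members of [O] are charged to [v], and each contributes [o v]. *)
have -> : \sum_(v in K) o v ^ 2 = \sum_(w in O) o (f w).
  rewrite [RHS](partition_big f (mem K)) /= => [|w wO]; last by have [] := fO w wO.
  apply: eq_bigr => v _; rewrite (eq_bigr (fun=> o v)) => [|w /andP[_ /eqP ->]] //.
  by rewrite -[X in _ = \sum_(_ | _) X]mul1n -big_distrl /= expnS expn1.
apply: leq_trans (_ : \sum_(w in O) #|[set: T] :&: S w| <= _).
  apply: leq_sum => w wO; rewrite setTI; apply: leq_trans (le_o _) _.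
  by have [] := fO w wO.
by rewrite -cardsT; apply: sum_disjoint.
Qed.

(** * The algorithm *)

Definition p_count (a : nat) (i : expr) (x : nat) (c : expr) : prog :=
  PFor x (PIf c (PSet a i (Add (Get a i) (Cst 1))) PSkip).

Lemma card_ord_ltS n (k : 'I_n) (P : pred 'I_n) :
  #|[set v : 'I_n | (v < k.+1) && P v]| =
  #|[set v : 'I_n | (v < k) && P v]| + P k.
Proof.
rewrite (cardsD1 k) !inE ltnSn /= addnC; congr (_ + _).
apply: eq_card => v; rewrite !inE ltnS (leq_eqVlt v) -val_eqE /=.
by case: ltngtP.
Qed.

Lemma den_count n a i x c (m : store) (P : pred 'I_n) :
  m 0 0 = n -> wf (p_count a i x c) ->
  (forall (v : 'I_n) (m1 : store), m1 x 0 = v ->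
     (forall b, b \notin [:: x; a] -> m1 b =1 m b) ->
     eval m1 i = eval m i /\ (eval m1 c != 0) = P v) ->
  den (p_count a i x c) m a (eval m i) = m a (eval m i) + #|[set v | P v]| /\
  forall j, j != eval m i -> den (p_count a i x c) m a j = m a j.
Proof.
move=> mn wfc Hc.
have ax : a != x by case/and3P: (wfc) => _; rewrite /= inE eq_sym.
pose Inv k (m1 : store) :=
  m1 a (eval m i) = m a (eval m i) + #|[set v : 'I_n | (v < k) && P v]| /\
  forall j, j != eval m i -> m1 a j = m a j.
suff: Inv n (den (p_count a i x c) m).
  case=> -> others; split=> //; congr (_ + _); apply: eq_card => v.
  by rewrite !inE ltn_ord.
apply: (den_for mn wfc).
  split=> [|j _]; rewrite update_neq //.
  by rewrite [X in _ + X]eq_card0 ?addn0 // => v; rewrite !inE.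
move=> k m1 m1x fr [Ik others].
have [Ei Ec] := Hc k m1 m1x fr.
rewrite /Inv card_ord_ltS; split=> [|j ji]; rewrite update_neq // den_if Ec.
  case: (P k); last by rewrite den_skip Ik addn0.
  by rewrite den_set /= Ei /update !eqxx /= Ik addnA.
case: (P k); last by rewrite den_skip others.
by rewrite den_set /= Ei /update (negPf ji) andbF others.
Qed.

Local Notation var x := (Get x (Cst 0)).
Local Notation inp := 0.
Local Notation out := 1.
Local Notation row := 2.
Local Notation par := 3.
Local Notation mat := 4.
Local Notation siz := 5.
Local Notation col := 6.
Local Notation blk := 7.
Local Notation chs := 8.
Local Notation cnt := 9.

(* Arrays 10 to 13 hold the loop counters. *)

Definition idx u v := Add (Get row (var u)) (var v).
Definition ent u v := Get mat (idx u v).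
Definition dpar := Get inp (Cst 1).

(** The machine has neither multiplication nor parity, so multiples of n ([row]) and parities
    ([par]) are tabulated. The diagonal of [mat] gets 1, standing for distance 0. *)
Definition p_init : prog :=
  PFor 10 (PSeq (PSet row (Add (var 10) (Cst 1)) (Add (Get row (var 10)) (var inp)))
    (PSeq (PSet par (Add (var 10) (Cst 1)) (Sub (Cst 1) (Get par (var 10))))
          (PSet mat (idx 10 10) (Cst 1)))).

(** In round k, a vertex 12 at distance k from vertex 10 gives its neighbour 11, if still unreached,
    distance k + 1. The offset 2 skips n and [d] in the input. *)
Definition p_relax : prog :=
  PIf (And (Eq (ent 10 12) (Add (var 13) (Cst 1)))
           (And (Get inp (Add (idx 12 11) (Cst 2))) (Not (ent 10 11))))
    (PSet mat (idx 10 11) (Add (var 13) (Cst 2))) PSkip.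

Definition p_level : prog := PFor 10 (PFor 11 (PFor 12 p_relax)).

Definition p_dist : prog := PFor 13 p_level.

(* The ball of radius (d - 2)/2, with truncated subtraction so that d = 0 *)
(* behaves as d = 2; entries of mat are distances plus one.               *)
Definition p_size : prog :=
  PFor 10 (p_count siz (var 10) 11
    (And (ent 10 11)
         (Le (Sub (Add (ent 10 11) (ent 10 11)) (Cst 2)) (Sub dpar (Cst 2))))).

Definition p_color : prog :=
  PFor 11 (PFor 10 (PIf (ent 10 11)
    (PSet col (var 11) (Add (Cst 1) (Get par (Sub (ent 10 11) (Cst 1))))) PSkip)).

Definition p_block : prog :=
  PFor 11 (PIf (And (ent 10 11) (And (Le (ent 10 11) dpar)
                                 (Not (Get par (Sub (ent 10 11) (Cst 1))))))
    (PSet blk (var 11) (Cst 1)) PSkip).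

(** Increasing ball size is achieved without sorting, by one pass over the vertices for each
    possible size. *)
Definition p_greedy : prog :=
  PFor 13 (PFor 10
    (PIf (And (Eq (Get siz (var 10)) (Add (var 13) (Cst 1))) (Not (Get blk (var 10))))
      (PSeq (PSet chs (var 10) (Cst 1)) p_block) PSkip)).

Definition chosen_col c := And (Get chs (var 11)) (Eq (Get col (var 11)) (Cst c)).

Definition p_out (c : nat) : prog :=
  PFor 11 (PIf (chosen_col c) (PSet out (var 11) (Cst 1)) PSkip).

Definition p_select : prog :=
  PSeq (p_count cnt (Cst 1) 11 (chosen_col 1))
 (PSeq (p_count cnt (Cst 2) 11 (chosen_col 2))
   (PIf (Sub (Get cnt (Cst 2)) (Get cnt (Cst 1))) (p_out 2) (p_out 1))).

Definition p_main : prog :=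
  PSeq p_init (PSeq p_dist (PSeq p_size (PSeq p_color (PSeq p_greedy p_select)))).

Lemma wf_main : wf p_main. Proof. by []. Qed.

Lemma eq_mxidx n (u v u' v' : 'I_n) :
  (u * n + v == u' * n + v') = (u == u') && (v == v').
Proof.
apply/eqP/andP => [E|[/eqP -> /eqP ->]] //.
have n0 : 0 < n by apply: leq_ltn_trans (ltn_ord u).
have := congr1 (divn^~ n) E; have := congr1 (modn^~ n) E.
rewrite !modnMDl !modn_small ?ltn_ord // !divnMDl // !divn_small // !addn0.
by move=> Ev Eu; split; apply/eqP; apply: val_inj.
Qed.

Section Algorithm.

Variables (n d : nat) (e : rel 'I_n).

(* Distance plus one, with 0 standing for infinity. *)
Definition dval (u v : 'I_n) : nat := if dist e u v is Some j then j.+1 else 0.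

Definition is_input (m : store) : Prop :=
  [/\ m inp 0 = n, m inp 1 = d &
      forall u v : 'I_n, m inp (u * n + v + 2) = e u v].

Definition tables (m : store) : Prop :=
  [/\ is_input m, forall j, j <= n -> m row j = j * n &
      forall j, j <= n -> m par j = odd j].

Definition dist_matrix (m : store) : Prop :=
  forall u v : 'I_n, m mat (u * n + v) = dval u v.

Lemma is_input_eq (m m1 : store) : m1 inp =1 m inp -> is_input m -> is_input m1.
Proof. by move=> E [mn md me]; split=> [||u v]; rewrite E. Qed.

Lemma tables_eq (m m1 : store) : m1 inp =1 m inp -> m1 row =1 m row ->
  m1 par =1 m par -> tables m -> tables m1.
Proof.
move=> E0 E2 E3 [mi mr mp]; split=> [|j lej|j lej].
- exact: is_input_eq mi.
- by rewrite E2 mr.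
- by rewrite E3 mp.
Qed.

Lemma dist_matrix_eq (m m1 : store) : m1 mat =1 m mat -> dist_matrix m -> dist_matrix m1.
Proof. by move=> E D u v; rewrite E. Qed.

Lemma den_init (m : store) : is_input m -> m row =1 (fun=> 0) ->
  m par =1 (fun=> 0) -> m mat =1 (fun=> 0) ->
  tables (den p_init m) /\
  forall u v : 'I_n, den p_init m mat (u * n + v) = (u == v).
Proof.
move=> mi r0 p0 M0; have [mn _ _] := mi.
pose Inv k (m1 : store) := [/\ forall j, j <= k -> m1 row j = j * n,
  forall j, j <= k -> m1 par j = odd j &
  forall u v : 'I_n, m1 mat (u * n + v) = (u < k) && (u == v)].
have: Inv n (den p_init m).
  apply: (den_for mn) => //.
    by split=> [j|j|u v]; rewrite update_neq // ?leqn0 ?r0 ?p0 ?M0 // => /eqP ->.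
  move=> k m1 m1k fr [rk pk Mk].
  have m1n : m1 0 0 = n by rewrite fr.
  rewrite !den_seq !den_set /= /update /= m1k m1n !addn1 !rk // !pk //.
  split=> [j|j|u v].
  - rewrite leq_eqVlt ltnS; case: eqP => [-> _|_] /=; last exact: rk.
    by rewrite mulSn addnC.
  - rewrite leq_eqVlt ltnS; case: eqP => [-> _|_] /=; last exact: pk.
    by case: (odd k).
  - rewrite [nat_of_ord k == k.+1]ltn_eqF //= ?rk //.
    rewrite eq_mxidx Mk ltnS (leq_eqVlt u) !(inj_eq val_inj).
    have [->|uk] /= := eqVneq u k; first by rewrite ltnn [k == v]eq_sym; case: eqP.
    by [].
case=> rk pk Mk; split; last by move=> u v; rewrite Mk ltn_ord.
by split=> //; apply: is_input_eq mi; apply: den_frame.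
Qed.

(** * All-pairs distances, level by level *)

Definition dcut k (u v : 'I_n) : nat :=
  if dist e u v is Some j then (if j <= k then j.+1 else 0) else 0.

(** Describes the matrix in the middle of round k. Updating in place is harmless: new entries are k
    + 2, while the test looks for k + 1. *)
Definition level_sound k (m : store) : Prop := forall u v : 'I_n,
  m mat (u * n + v) = dcut k u v \/ m mat (u * n + v) = dcut k.+1 u v.

Definition relaxed k (u v w : 'I_n) (m : store) : Prop :=
  dist e u w = Some k -> e w v -> m mat (u * n + v) != 0.

Lemma den_relax k (u v w : 'I_n) (m : store) : tables m ->
  m 10 0 = u -> m 11 0 = v -> m 12 0 = w -> m 13 0 = k -> level_sound k m ->
  [/\ level_sound k (den p_relax m), relaxed k u v w (den p_relax m) &
      forall u' v' w', relaxed k u' v' w' m -> relaxed k u' v' w' (den p_relax m)].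
Proof.
case=> [[mn md me] mr mp] mu mv mw mk sm.
rewrite den_if !nzE /= mu mv mw mk !mr 1?ltnW // me addn1.
have Mw : (m mat (u * n + w) == k.+1) = (dist e u w == Some k).
  case: (sm u w) => ->; rewrite /dcut; case: (dist e u w) => [j|] //;
  rewrite -[Some j == _]/(j == k); case: leqP; lia.
rewrite Mw; case: ifP => [/and3P[/eqP uw wv /eqP M0]|nrel].
  rewrite den_set /= mu mv mk !mr 1?ltnW //.
  have wv' : e w v by case: (e w v) wv.
  have uv : dist e u v = Some k.+1.
    have [j uvj lej] := dist_succ uw wv'; rewrite uvj; congr Some.
    have [] := sm u v; rewrite M0 /dcut uvj; last by rewrite lej.
    by case: leqP => //; lia.
  split.
  - move=> u' v'; rewrite /update /= eq_mxidx.
    case: andP => [[/eqP -> /eqP ->]|_]; last exact: sm.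
    by right; rewrite /dcut uv leqnn addn2.
  - by move=> _ _; rewrite /update /= eqxx addn2.
  - move=> u' v' w' H uw' wv''; rewrite /update /=.
    by case: ifP => // _; [rewrite addn2 | apply: H].
rewrite den_skip; split=> // uw wv; apply/negP => M0.
by move: nrel; rewrite uw wv M0 eqxx.
Qed.

Definition relaxed_all (S : 'I_n -> 'I_n -> 'I_n -> bool) k m : Prop :=
  level_sound k m /\ forall u v w, S u v w -> relaxed k u v w m.

Lemma relaxed_all_eq (S S' : 'I_n -> 'I_n -> 'I_n -> bool) k (m m' : store) :
  m' mat =1 m mat -> (forall u v w, S' u v w -> S u v w) ->
  relaxed_all S k m -> relaxed_all S' k m'.
Proof.
move=> E sS [sm Rm]; split=> [u v|u v w /sS Suvw uw wv]; rewrite E //.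
exact: Rm Suvw uw wv.
Qed.

Lemma den_level k (m : store) : tables m -> m 13 0 = k ->
  level_sound k m -> relaxed_all (fun _ _ _ => true) k (den p_level m).
Proof.
move=> tm mk sm; have [[mn _ _] _ _] := tm.
(* The triples already handled form initial segments of the lexicographic order, one family for each
   nesting depth. *)
pose S1 i (u v w : 'I_n) := u < i.
pose S2 (u0 : 'I_n) i (u v w : 'I_n) := (u < u0) || (u == u0) && (v < i).
pose S3 (u0 v0 : 'I_n) i (u v w : 'I_n) :=
  [|| u < u0, (u == u0) && (v < v0) | [&& u == u0, v == v0 & w < i]].
suff: relaxed_all (S1 n) k (den p_level m).
  by apply: relaxed_all_eq => // u v w _; rewrite /S1 ltn_ord.
apply: (den_for (Inv := fun i => relaxed_all (S1 i) k) mn) => //.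
move=> u m1 m1u fr1 I1.
have m1n : m1 0 0 = n by rewrite fr1.
have : relaxed_all (S2 u n) k (den (PFor 11 (PFor 12 p_relax)) m1).
  apply: (den_for (Inv := fun i => relaxed_all (S2 u i) k) m1n) => //.
    apply: relaxed_all_eq I1 => // u' v' w'.
    by rewrite /S2 ltn0 andbF orbF.
  move=> v m2 m2v fr2 I2.
  have m2n : m2 0 0 = n by rewrite fr2.
  have : relaxed_all (S3 u v n) k (den (PFor 12 p_relax) m2).
    apply: (den_for (Inv := fun i => relaxed_all (S3 u v i) k) m2n) => //.
      apply: relaxed_all_eq I2 => // u' v' w'.
      by rewrite /S3 ltn0 !andbF orbF.
    move=> w m3 m3w fr3 [s3 R3].
    have t3 : tables m3 by apply: tables_eq tm => j; rewrite fr3 // fr2 // fr1.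
    have m3u : m3 10 0 = u by rewrite fr3 // fr2.
    have m3v : m3 11 0 = v by rewrite fr3.
    have m3k : m3 13 0 = k by rewrite fr3 // fr2 // fr1.
    have [s4 R4 mono] := den_relax t3 m3u m3v m3w m3k s3.
    apply: (@relaxed_all_eq (S3 u v w.+1) _ _ (den p_relax m3)) => //.
    split=> // u' v' w'; rewrite /S3 ltnS (leq_eqVlt w') => H.
    have [H3|nH3] := boolP (S3 u v w u' v' w'); first by apply: mono; apply: R3.
    suff [-> -> ->] : [/\ u' = u, v' = v & w' = w] by [].
    move: H nH3; rewrite /S3 (inj_eq val_inj).
    case: (u' < u) => //; case: (u' =P u) => // ->; case: (v' < v) => //.
    by case: (v' =P v) => //= ->; case: (w' < w) => //; case: (w' =P w) => //= ->.
  apply: relaxed_all_eq => // u' v' w'.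
  rewrite /S2 /S3 ltn_ord andbT ltnS (leq_eqVlt v') (inj_eq val_inj).
  by case: (u' < u); case: (u' == u); case: (v' < v); case: (v' == v).
apply: relaxed_all_eq => // u' v' w'.
by rewrite /S2 /S1 ltn_ord andbT ltnS (leq_eqVlt u') (inj_eq val_inj) orbC.
Qed.

Lemma den_dist (m : store) : tables m ->
  (forall u v : 'I_n, m mat (u * n + v) = (u == v)) ->
  dist_matrix (den p_dist m).
Proof.
move=> tm Mm; have [[mn _ _] _ _] := tm.
pose Inv k (m1 : store) := forall u v : 'I_n, m1 mat (u * n + v) = dcut k u v.
have: Inv n (den p_dist m).
  apply: (den_for mn) => //.
    move=> u v; rewrite update_neq // Mm /dcut -(dist_eq0 e).
    by case: (dist e u v) => [[|j]|].
  move=> k m1 m1k fr I1.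
  have t1 : tables m1 by apply: tables_eq tm => j; rewrite fr.
  have [] := den_level t1 m1k; first by move=> u v; left.
  move=> s2 R2 u v; rewrite update_neq //.
  have [E|-> //] := s2 u v; rewrite E /dcut.
  case uv: (dist e u v) => [j|//]; case: (ltngtP j k.+1) => lejk.
  - by rewrite -ltnS lejk.
  - by case: leqP => //; lia.
  (* At distance k + 1 the entry cannot still be 0: the predecessor on a shortest walk gives a
     triple that was relaxed. *)
  exfalso; move: uv; rewrite lejk => uv; have [w uw wv] := dist_pred uv.
  by have := R2 u v w isT uw wv; rewrite E /dcut uv ltnn.
move=> I u v; rewrite I /dcut /dval; case uv: (dist e u v) => [j|//].
by have := dist_lt_card uv; rewrite card_ord => /ltnW ->.
Qed.

(** * Ball sizes and colours *)

Lemma eval_ent (m : store) x y (u v : 'I_n) : tables m -> dist_matrix m ->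
  m x 0 = u -> m y 0 = v -> eval m (ent x y) = dval u v.
Proof. by move=> [_ mr _] Dm mu mv; rewrite /= mu mv mr ?Dm // ltnW. Qed.

Lemma dval_le (u v : 'I_n) : dval u v <= n.
Proof.
rewrite /dval; case uv: (dist e u v) => [j|//].
by have := dist_lt_card uv; rewrite card_ord.
Qed.

Lemma dval_gt0 (u v : 'I_n) : (dval u v != 0) = connect e u v.
Proof. by rewrite -dist_connect /dval; case: (dist e u v). Qed.

Lemma den_size (m : store) : tables m -> dist_matrix m ->
  m siz =1 (fun=> 0) ->
  forall u : 'I_n, den p_size m siz u = #|cball e (d - 2)./2 u|.
Proof.
move=> tm Dm s0; have [[mn md _] _ _] := tm.
pose Inv i (m1 : store) := forall u : 'I_n,
  m1 siz u = if u < i then #|cball e (d - 2)./2 u| else 0.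
suff: Inv n (den p_size m) by move=> I u; rewrite I ltn_ord.
apply: (den_for mn) => // [u|i m1 m1i fr Ii]; first by rewrite update_neq ?s0.
have t1 : tables m1 by apply: tables_eq tm => j; rewrite fr.
have D1 : dist_matrix m1 by apply: dist_matrix_eq Dm => j; rewrite fr.
have m1n : m1 0 0 = n by rewrite fr.
have [|v m2 m2v fr2|Ei others] := @den_count n siz (var 10) 11
  (And (ent 10 11) (Le (Sub (Add (ent 10 11) (ent 10 11)) (Cst 2)) (Sub dpar (Cst 2))))
  m1 [pred v | v \in cball e (d - 2)./2 i] m1n => //.
  have t2 : tables m2 by apply: tables_eq t1 => j; rewrite fr2.
  have D2 : dist_matrix m2 by apply: dist_matrix_eq D1 => j; rewrite fr2.
  have m2i : m2 10 0 = i by rewrite fr2.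
  have m2d : m2 0 1 = d by rewrite fr2 // fr.
  split; first by rewrite /= fr2.
  have E := eval_ent t2 D2 m2i m2v.
  rewrite /= in E; rewrite !nzE /= !E m2d inE /dval.
  (* At distance j the entry is j + 1, and the test 2j <= d - 2 amounts to j <= (d-2)/2 without a
     division. *)
  by case: (dist e i v) => [j|] //; lia.
move=> u; rewrite update_neq //; rewrite /= m1i in Ei others.
have [->|ui] := eqVneq u i; first by rewrite Ei Ii ltnn ltnSn cardsE.
by rewrite others // Ii ltnS [u <= i]leq_eqVlt (inj_eq val_inj) (negPf ui).
Qed.

(* The colour of v after the first j rounds: the parity, shifted to {1, 2}, *)
(* of the distance to the last vertex below j that is connected to v.       *)
Fixpoint color_upto (v : 'I_n) (j : nat) : nat :=
  if j is i.+1 then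
    if insub i is Some u then
      if dval u v != 0 then 1 + odd (dval u v - 1) else color_upto v i
    else 0
  else 0.

Lemma color_uptoS (v k : 'I_n) : color_upto v k.+1 =
  if dval k v != 0 then 1 + odd (dval k v - 1) else color_upto v k.
Proof. by rewrite /= valK. Qed.

Lemma den_color (m : store) : tables m -> dist_matrix m ->
  m col =1 (fun=> 0) -> forall v : 'I_n, den p_color m col v = color_upto v n.
Proof.
move=> tm Dm s0; have [[mn md _] _ _] := tm.
pose Inv i (m1 : store) := forall v : 'I_n,
  m1 col v = if v < i then color_upto v n else 0.
suff: Inv n (den p_color m) by move=> I u; rewrite I ltn_ord.
apply: (den_for mn) => // [u|v m1 m1v fr Iv]; first by rewrite update_neq ?s0.
pose Inv2 i (m2 : store) := forall v' : 'I_n,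
  m2 col v' = if v' < v then color_upto v' n else
              if v' == v then color_upto v i else 0.
set p := PFor 10 _.
have m1n : m1 0 0 = n by rewrite fr.
have: Inv2 n (den p m1).
  apply: (den_for m1n) => // [v'|u m2 m2u fr2 Iu].
    by rewrite update_neq // Iv /=; case: ifP => //; case: ifP.
  have t2 : tables m2 by apply: tables_eq tm => j; rewrite fr2 // fr.
  have D2 : dist_matrix m2 by apply: dist_matrix_eq Dm => j; rewrite fr2 // fr.
  have m2v : m2 11 0 = v by rewrite fr2.
  move=> v'; rewrite update_neq // den_if (eval_ent t2 D2 m2u m2v) color_uptoS.
  case: ifP => uv; last by rewrite den_skip Iu.
  rewrite den_set -[eval m2 (Add _ _)]/(1 + m2 par (eval m2 (ent 10 11) - 1)).
  rewrite (eval_ent t2 D2 m2u m2v); have [_ _ mp] := t2.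
  rewrite mp /update /= ?m2v ?(inj_eq val_inj); last first.
    by rewrite (leq_trans (leq_subr _ _)) ?dval_le.
  rewrite Iu; case: (v' =P v) => [->|_] //=; by rewrite ltnn.
move=> I2 v'; rewrite update_neq // I2 ltnS [v' <= v]leq_eqVlt (inj_eq val_inj).
by case: eqP => [->|_] /=; [rewrite ltnn | case: ifP].
Qed.

Lemma color_upto_le2 v j : color_upto v j <= 2.
Proof.
elim: j => //= i IHi; case: insub => // u; case: ifP => // _.
by case: (odd _).
Qed.

(** Round [v] colours [v], which is connected to itself, and no later round resets a colour to 0. *)
Lemma color_upto_gt0 v : color_upto v n != 0.
Proof.
suff H j : v < j -> j <= n -> color_upto v j != 0 by apply: H.
elim: j => // i IHi; rewrite ltnS => lvi lin.
rewrite (color_uptoS v (Ordinal lin)); case: ifP => // /negbT vi.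
apply: IHi (ltnW lin); rewrite ltn_neqAle lvi andbT; apply: contraNneq vi => vi.
suff -> : Ordinal lin = v by rewrite dval_gt0 connect0.
exact: val_inj.
Qed.

(** Connected vertices are recoloured in the same rounds from the same reference vertex w, and the
    parity of the distance from w tells whether a vertex is on the side of w. *)
Lemma color_upto_parity (A B : {set 'I_n}) u v j :
  symmetric e -> bipartition e A B -> connect e u v -> j <= n ->
  (color_upto u j == 0) = (color_upto v j == 0) /\
  (color_upto u j != 0 ->
   (color_upto u j == color_upto v j) = ((u \in A) == (v \in A))).
Proof.
move=> sym_e bip uv; elim: j => [|i IHi] lin //.
have [E1 E2] := IHi (ltnW lin).
rewrite !(color_uptoS _ (Ordinal lin)); set w := Ordinal lin.
have Ew : connect e w u = connect e w v.
  by rewrite !(sym_connect_sym sym_e w) (same_connect (sym_connect_sym sym_e) uv).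
have par_w x : connect e w x -> odd (dval w x - 1) = (w \in A) (+) (x \in A).
  rewrite -dval_gt0 /dval; case wx: (dist e w x) => [k|//] _.
  by rewrite subn1 /= (walk_parity bip (dist_walk wx)).
rewrite !dval_gt0 -Ew; case: ifP => // wu; split=> // _.
rewrite !par_w -?Ew //.
by case: (w \in A); case: (u \in A); case: (v \in A).
Qed.

(* Even distance, smaller than d. *)
Definition conf (u v : 'I_n) : bool :=
  [&& dval u v != 0, dval u v <= d & ~~ odd (dval u v - 1)].

Lemma den_block (m : store) (u : 'I_n) : tables m -> dist_matrix m ->
  m 10 0 = u ->
  forall w : 'I_n, (den p_block m blk w != 0) = (m blk w != 0) || conf u w.
Proof.
move=> tm Dm mu; have [[mn md _] _ _] := tm.
pose Inv i (m1 : store) := forall w : 'I_n,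
  (m1 blk w != 0) = (m blk w != 0) || (w < i) && conf u w.
suff: Inv n (den p_block m) by move=> I w; rewrite I ltn_ord.
apply: (den_for mn) => // [w|v m1 m1v fr Iv]; first by rewrite update_neq ?orbF.
have t1 : tables m1 by apply: tables_eq tm => j; rewrite fr.
have D1 : dist_matrix m1 by apply: dist_matrix_eq Dm => j; rewrite fr.
have m1u : m1 10 0 = u by rewrite fr.
have [[_ m1d _] _ mp] := t1.
have E := eval_ent t1 D1 m1u m1v.
move=> w; rewrite update_neq // den_if !nzE E [eval m1 dpar]/= m1d.
rewrite -[eval m1 (Get par _)]/(m1 par (eval m1 (ent 10 11) - 1)) E mp; last first.
  by rewrite (leq_trans (leq_subr _ _)) ?dval_le.
rewrite eqb0 -/(conf u v) ltnS [w <= v]leq_eqVlt (inj_eq val_inj).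
case: ifP => uv.
  rewrite den_set /update /= m1v (inj_eq val_inj).
  by case: (w =P v) => [->|_] /=; [rewrite uv orbT | apply: Iv].
rewrite den_skip Iv; case: (w =P v) => [->|_] //=.
by rewrite uv andbF.
Qed.

(** [D] holds of the vertices already treated. The case [v = w] is needed since for [d = 0] a vertex
    is not in conflict with itself. The last clause ensures that whatever blocks a vertex has no
    larger ball. *)
Definition greedy_state (sz : 'I_n -> nat) (D : pred 'I_n) (s : nat)
    (m : store) : Prop :=
  [/\ forall w : 'I_n, (m blk w != 0) = [exists v : 'I_n, (m chs v != 0) && conf v w],
      forall u v : 'I_n, m chs u != 0 -> m chs v != 0 -> u != v -> ~~ conf u v,
      forall w : 'I_n, D w -> exists v : 'I_n,
        [/\ m chs v != 0, v = w \/ conf v w & sz v <= sz w] &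
      forall v : 'I_n, m chs v != 0 -> sz v <= s].

Lemma greedy_state_eq sz (D D' : pred 'I_n) s s' (m m' : store) :
  m' blk =1 m blk -> m' chs =1 m chs -> (forall w, D' w -> D w) -> s <= s' ->
  greedy_state sz D s m -> greedy_state sz D' s' m'.
Proof.
move=> Eb Ec sD les [G1 G2 G3 G4]; split=> [w|u v|w /sD /G3[v Hv]|v].
- by rewrite Eb G1; apply: eq_existsb => v; rewrite Ec.
- by rewrite !Ec; apply: G2.
- by exists v; rewrite Ec.
- by rewrite Ec => /G4 /leq_trans; apply.
Qed.

Lemma dist_sym (u v : 'I_n) : symmetric e -> dist e u v = dist e v u.
Proof.
move=> sym_e; case uv: (dist e v u) => [k|].
  have [wk mink] := (dist_spec _ _ _ _).1 uv.
  apply/dist_spec; split=> [|j /(has_walk_sym sym_e) /mink //].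
  exact: has_walk_sym.
case vu: (dist e u v) => [k|//].
by have [j] := has_walk_dist (has_walk_sym sym_e (dist_walk vu)); rewrite uv.
Qed.

Lemma conf_sym u v : symmetric e -> conf u v = conf v u.
Proof. by move=> sym_e; rewrite /conf /dval dist_sym. Qed.

Lemma den_greedy (m : store) sz : symmetric e -> tables m -> dist_matrix m ->
  m blk =1 (fun=> 0) -> m chs =1 (fun=> 0) ->
  (forall u : 'I_n, m siz u = sz u) -> (forall u, 0 < sz u <= n) ->
  greedy_state sz predT n (den p_greedy m).
Proof.
move=> sym_e tm Dm b0 c0 ms szn; have [[mn md _] _ _] := tm.
(* Progress is lexicographic in size and index. Sizes are positive, so [D1 0] is empty, and at most
   n, so [D1 n] is everything. *)
pose D1 i := [pred w | sz w <= i].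
pose D2 s i := [pred w : 'I_n | (sz w <= s) || (sz w == s.+1) && (w < i)].
suff: greedy_state sz (D1 n) n (den p_greedy m).
  by apply: greedy_state_eq => // w _; rewrite /= ; have /andP[] := szn w.
apply: (den_for (Inv := fun i => greedy_state sz (D1 i) i) mn) => //.
  split=> [w|u v|w|v]; rewrite ?update_neq ?b0 ?c0 //; last first.
    by rewrite /=; have := szn w; lia.
  by apply/esym/existsP => -[v]; rewrite update_neq // c0.
move=> s m1 m1s fr1 I1; set p := PFor 10 _.
have m1n : m1 0 0 = n by rewrite fr1.
suff: greedy_state sz (D2 s n) s.+1 (den p m1).
  apply: greedy_state_eq => // w /=; rewrite ltn_ord; lia.
apply: (den_for (Inv := fun i => greedy_state sz (D2 s i) s.+1) m1n) => //.
  by apply: greedy_state_eq I1 => // w /=; rewrite ltn0 andbF orbF.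
move=> u m2 m2u fr2 I2; set q := PIf _ _ _.
have t2 : tables m2 by apply: tables_eq tm => j; rewrite fr2 // fr1.
have D2' : dist_matrix m2 by apply: dist_matrix_eq Dm => j; rewrite fr2 // fr1.
have m2s : m2 13 0 = s by rewrite fr2.
have m2z : m2 siz u = sz u by rewrite fr2 // fr1.
have D2S w : D2 s u.+1 w -> D2 s u w \/ w = u /\ sz u = s.+1.
  rewrite /= ltnS [w <= u]leq_eqVlt (inj_eq val_inj).
  by case: (w =P u) => [->|_]; [case: eqP; [right|left; lia] | left].
suff: greedy_state sz (D2 s u.+1) s.+1 (den q m2) by apply: greedy_state_eq.
have [G1 G2 G3 G4] := I2.
rewrite /q den_if !nzE /= m2u m2s m2z addn1; case: ifP => [/andP[/eqP su /eqP bu]|nsel].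
  rewrite den_seq den_set /= m2u.
  set m3 := update _ _ _ _.
  have c3 w : den p_block m3 chs w = if w == u then 1 else m2 chs w.
    by rewrite den_frame.
  have c3' (w : 'I_n) : (den p_block m3 chs w != 0) = (w == u) || (m2 chs w != 0).
    by rewrite c3 (inj_eq val_inj); case: (w == u).
  have noconf (v : 'I_n) : m2 chs v != 0 -> ~~ conf v u.
    move=> cv; apply: contra_eqN bu => vu; rewrite G1.
    by apply/existsP; exists v; rewrite cv.
  split=> [w|v w|w Dw|v].
  - have t3 : tables m3 by apply: tables_eq t2.
    have D3 : dist_matrix m3 by apply: dist_matrix_eq D2'.
    rewrite (den_block t3 D3 m2u) -[m3 blk w]/(m2 blk w) G1.
    apply/orP/existsP => [[/existsP[v /andP[cv vw]]|uw]|[v]].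
    + by exists v; rewrite c3' cv orbT.
    + by exists u; rewrite c3' eqxx.
    rewrite c3' => /andP[/orP[/eqP -> uw|cv vw]]; first by right.
    by left; apply/existsP; exists v; rewrite cv.
  - rewrite !c3' => /orP[/eqP ->|cv] /orP[/eqP ->|cw]; rewrite ?eqxx // => vw.
    + by rewrite conf_sym ?noconf.
    + exact: noconf.
    + exact: G2.
  - have [/G3[v [cv vw zv]]|[-> _]] := D2S w Dw.
      by exists v; rewrite c3' cv orbT.
    by exists u; rewrite c3' eqxx; split=> //; left.
  - by rewrite c3' => /orP[/eqP ->|/G4 //]; rewrite su.
rewrite den_skip; split=> // w Dw.
have [/G3 //|[-> su]] := D2S w Dw.
(* A vertex of the current size is passed over only when blocked; its blocker serves as the
   witness. *)
have: m2 blk u != 0 by apply/negP => bu; move: nsel; rewrite su eqxx bu.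
rewrite G1 => /existsP[v /andP[cv vu]]; exists v; split=> //; first by right.
by rewrite su G4.
Qed.

(** * Choice of the larger colour class *)

Definition class (m : store) c : {set 'I_n} :=
  [set v : 'I_n | (m chs v != 0) && (m col v == c)].

Lemma den_out (m : store) c : m 0 0 = n -> m out =1 (fun=> 0) ->
  output n (den (p_out c) m) = class m c.
Proof.
move=> mn o0; apply/setP => v; rewrite !inE.
pose Inv i (m1 : store) := forall v : 'I_n,
  (m1 out v != 0) = [&& v < i, m chs v != 0 & m col v == c].
suff: Inv n (den (p_out c) m) by move=> ->; rewrite ltn_ord.
apply: (den_for mn) => // [w|u m1 m1u fr Iu w]; first by rewrite update_neq ?o0.
rewrite update_neq // den_if !nzE /= m1u !fr //.
rewrite ltnS [w <= u]leq_eqVlt (inj_eq val_inj).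
case: ifP => uc.
  rewrite den_set /update /= m1u (inj_eq val_inj).
  by case: (w =P u) => [->|_] /=; [rewrite uc | apply: Iu].
rewrite den_skip Iu; case: (w =P u) => [->|_] //=.
by rewrite uc andbF.
Qed.

Lemma den_select (m : store) : m 0 0 = n -> m out =1 (fun=> 0) ->
  m cnt =1 (fun=> 0) ->
  exists c, [/\ output n (den p_select m) = class m c,
    #|class m 1| <= #|class m c| & #|class m 2| <= #|class m c|].
Proof.
move=> mn o0 t0; rewrite !den_seq.
set m1 := den _ m; set m2 := den _ m1.
have f1 a : a \notin [:: 11; 9] -> m1 a =1 m a by move=> ha j; rewrite /m1 den_frame.
have f2 a : a \notin [:: 11; 9] -> m2 a =1 m a.
  by move=> ha j; rewrite /m2 den_frame ?f1.
have cls c (m' : store) (v : 'I_n) : m' 11 0 = v -> m' chs =1 m chs -> m' col =1 m col ->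
    (eval m' (chosen_col c) != 0) = (m chs v != 0) && (m col v == c).
  by move=> mv E8 E6; rewrite !nzE /= mv E8 E6.
have [|v m' mv fr|N1 O1] := @den_count n cnt (Cst 1) 11 (chosen_col 1) m
    [pred v : 'I_n | (m chs v != 0) && (m col v == 1)] mn => //.
  by split=> //; apply: cls => // j; rewrite fr.
have m1n : m1 0 0 = n by rewrite f1.
have [|v m' mv fr|N2 O2] := @den_count n cnt (Cst 2) 11 (chosen_col 2) m1
    [pred v : 'I_n | (m chs v != 0) && (m col v == 2)] m1n => //.
  by split=> //; apply: cls => // j; rewrite fr // f1.
have C1 : m2 cnt 1 = #|class m 1| by rewrite [LHS]O2 // [LHS]N1 t0.
have C2 : m2 cnt 2 = #|class m 2| by rewrite [LHS]N2 [m1 _ _]O1 // t0.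
have Ec c : class m2 c = class m c by apply/setP => v; rewrite !inE !f2.
rewrite den_if /= C1 C2; case: ifP => le.
  exists 2; rewrite den_out ?Ec ?f2 //; last by move=> j; rewrite f2.
  by split=> //; move: le; rewrite subn_eq0 -ltnNge => /ltnW.
exists 1; rewrite den_out ?Ec ?f2 //; last by move=> j; rewrite f2.
by split=> //; move/negbFE: le; rewrite subn_eq0.
Qed.

End Algorithm.

(** * Approximation ratio *)

Section Approximation.

Variables (n d : nat) (e : rel 'I_n) (A B : {set 'I_n}).
Hypotheses (even_d : ~~ odd d) (sym_e : symmetric e) (bip : bipartition e A B).

Lemma eq_color_parity u v k : dist e u v = Some k ->
  (color_upto e u n == color_upto e v n) = ~~ odd k.
Proof.
move=> uv; have cuv := has_walk_connect (dist_walk uv).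
have [_ ->] := color_upto_parity sym_e bip cuv (leqnn n).
  rewrite (walk_parity bip (dist_walk uv)).
  by case: (u \in A); case: (v \in A).
exact: color_upto_gt0.
Qed.

Lemma conf_dist u v : conf d e u v ->
  exists2 k, dist e u v = Some k.*2 & k <= (d - 2)./2.
Proof.
rewrite /conf /dval; case uv: (dist e u v) => [j|//] /and3P[_ lejd].
rewrite subn1 /= => evj; exists j./2; first by rewrite even_halfK.
by move: evj; lia.
Qed.

Variable m : store.
Hypothesis colm : forall v : 'I_n, m col v = color_upto e v n.
Hypothesis Gm :
  greedy_state d e (fun u => #|cball e (d - 2)./2 u|) predT n m.

(** Within a colour a finite distance is even, so if it were below [d] the two vertices would be in
    conflict. *)
Lemma scattered_class c : scattered e d (class n m c).
Proof.
have [_ G2 _ _] := Gm.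
apply/forall_inP => u; rewrite inE colm => /andP[Ku /eqP cu].
apply/forall_inP => v; rewrite inE colm => /andP[Kv /eqP cv]; apply/implyP => uv.
rewrite /dist_ge; case duv: (dist e u v) => [k|//].
rewrite leqNgt; apply: contra (G2 u v Ku Kv uv) => ltkd.
by rewrite /conf /dval duv /= ltkd subn1 /= -(eq_color_parity duv) cu cv.
Qed.

(** Each [w] is charged to itself or to a chosen vertex in conflict with it; the even distance keeps
    the charge within the colour, as [packing_charge] requires. *)
Lemma scattered_class_bound (O : {set 'I_n}) c : scattered e d O ->
  #|[set w in O | color_upto e w n == c]| ^ 2 <= #|class n m c| * n.
Proof.
move=> sO; have [_ _ G3 _] := Gm.
pose r := (d - 2)./2.
pose good w v := [&& m chs (nat_of_ord v) != 0, (v == w) || conf d e v w &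
                     #|cball e r v| <= #|cball e r w|].
pose f w := odflt w [pick v | good w v].
have fP w : good w (f w).
  rewrite /f; case: pickP => //= none; have [v [cv vw zv]] := G3 w isT.
  by have := none v; rewrite /good cv zv andbT /=; case: vw => ->; rewrite ?eqxx ?orbT.
rewrite -[n in _ * n]card_ord; apply: (@packing_charge _ (cball e r) _ _ f).
  move=> u v; rewrite !inE => /andP[uO _] /andP[vO _] uv.
  apply: cball_disjoint => //; move/forall_inP: sO => /(_ u uO) /forall_inP /(_ v vO).
  by rewrite uv.
move=> w; rewrite inE => /andP[wO /eqP cw]; have /and3P[Kf fw szf] := fP w.
case/orP: fw => [/eqP E|/conf_dist[k dk lek]].
  rewrite E in Kf *; split=> //; first by rewrite inE Kf colm cw eqxx.
  apply/set0Pn; exists w; rewrite setIid (cball_walk (k := 0)) //.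
  by rewrite has_walk0.
split=> //; last exact: cball_meet sym_e (dist_walk dk) lek.
by rewrite inE Kf colm -cw (eq_color_parity dk) odd_double.
Qed.

Lemma OPT_bound c : #|class n m 1| <= #|class n m c| ->
  #|class n m 2| <= #|class n m c| -> OPT e d ^ 2 <= 4 * n * #|class n m c| ^ 2.
Proof.
move=> le1 le2.
have [|O sO EOPT] := @eq_bigmax_cond _ (scattered e d) (fun K : {set 'I_n} => #|K|).
  apply/card_gt0P; exists set0; rewrite unfold_in.
  by apply/forall_inP => u; rewrite inE.
have -> : OPT e d = #|O| := EOPT.
have EO : #|O| = #|[set w in O | color_upto e w n == 1]| +
                 #|[set w in O | color_upto e w n == 2]|.
  rewrite -cardsUI [X in _ + X]eq_card0 ?addn0; last first.
    by move=> w; rewrite !inE; case: (w \in O) => //=; case: eqP => // ->.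
  apply: eq_card => w; rewrite !inE -andb_orr.
  by have := color_upto_gt0 e w; have := color_upto_le2 e w n; 
     case: (color_upto e w n) => [|[|[|]]] //; rewrite andbT.
have := scattered_class_bound 1 sO; have := scattered_class_bound 2 sO.
rewrite EO; move: le1 le2.
move: #|class n m c| #|class n m 1| #|class n m 2| => k k1 k2.
move: #|_| => b; move: #|_| => a le1 le2 Hb Ha.
have Ha' : a ^ 2 <= k * n by apply: leq_trans Ha _; rewrite leq_mul2r le1 orbT.
have Hb' : b ^ 2 <= k * n by apply: leq_trans Hb _; rewrite leq_mul2r le2 orbT.
(* This weakening trades the sharper bound 4nk for the form k^2 that a ratio needs. *)
have Hk : k * n <= k ^ 2 * n.
  rewrite -mulnn leq_mul2r; apply/orP; right.
  by case: (posnP k) => [->|?] //; apply: leq_pmull.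
have := nat_Cauchy a b; rewrite sqrnD; nia.
Qed.

End Approximation.

(** * Input encoding and assembly *)

Lemma nth_allpairs (S T U : Type) (f : S -> T -> U) s t x0 y0 z0 i j :
  i < size s -> j < size t ->
  nth z0 [seq f x y | x <- s, y <- t] (i * size t + j) =
  f (nth x0 s i) (nth y0 t j).
Proof.
elim: s i => [|x s IHs] [|i] //= lti ltj; rewrite nth_cat size_map.
  by rewrite ltj (nth_map y0).
by rewrite mulSn -addnA ltnNge leq_addr /= addKn IHs.
Qed.

Lemma is_input_encode n d (e : rel 'I_n) : is_input d e (init (encode e d)).
Proof.
split=> // u v; rewrite addn2 /init /encode /=.
have := @nth_allpairs _ _ _ (fun u v => nat_of_bool (e u v)) (enum 'I_n) (enum 'I_n)
  u v 0 u v.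
by rewrite size_enum_ord !nth_ord_enum; apply.
Qed.

Lemma den_main n d (e : rel 'I_n) (A B : {set 'I_n}) :
  ~~ odd d -> symmetric e -> bipartition e A B ->
  let m := den p_main (init (encode e d)) in
  scattered e d (output n m) /\ OPT e d ^ 2 <= 4 * n * #|output n m| ^ 2.
Proof.
move=> even_d sym_e bip /=; rewrite /p_main !den_seq.
set m0 := init _; have i0 : is_input d e m0 := is_input_encode d e.
set m1 := den p_init m0.
have [t1 M1] : tables d e m1 /\ _ :=
  den_init i0 (frefl _) (frefl _) (frefl _).
set m2 := den p_dist m1; have D2 : dist_matrix e m2 := den_dist t1 M1.
have f2 a : a \notin writes p_dist -> m2 a =1 m1 a by apply: den_frame.
have t2 : tables d e m2 by apply: tables_eq t1; apply: f2.
set m3 := den p_size m2.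
have f3 a : a \notin writes p_size -> m3 a =1 m2 a by apply: den_frame.
have z1 a : a \notin 0 :: writes p_init -> m1 a =1 fun=> 0.
  rewrite inE => /norP[a0 ap] j.
  by rewrite /m1 den_frame // /m0 /init (negPf a0).
have S3 (u : 'I_n) : m3 siz u = #|cball e (d - 2)./2 u|.
  by rewrite /m3 (den_size t2 D2) // => j; rewrite f2 // z1.
have t3 : tables d e m3 by apply: tables_eq t2; apply: f3.
have D3 : dist_matrix e m3 by apply: dist_matrix_eq D2; apply: f3.
set m4 := den p_color m3.
have f4 a : a \notin writes p_color -> m4 a =1 m3 a by apply: den_frame.
have C4 (v : 'I_n) : m4 col v = color_upto e v n.
  by rewrite /m4 (den_color t3 D3) // => j; rewrite f3 // f2 // z1.
have t4 : tables d e m4 by apply: tables_eq t3; apply: f4.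
have D4 : dist_matrix e m4 by apply: dist_matrix_eq D3; apply: f4.
set m5 := den p_greedy m4.
have f5 a : a \notin writes p_greedy -> m5 a =1 m4 a by apply: den_frame.
have G5 : greedy_state d e (fun u => #|cball e (d - 2)./2 u|) predT n m5.
  apply: den_greedy => // [j|j|u|u].
  - by rewrite f4 // f3 // f2 // z1.
  - by rewrite f4 // f3 // f2 // z1.
  - by rewrite f4 // S3.
  - apply/andP; split; last by rewrite -[X in _ <= X]card_ord max_card.
    apply/card_gt0P; exists u.
    by rewrite (cball_walk (k := 0)) ?has_walk0.
have C5 (v : 'I_n) : m5 col v = color_upto e v n by rewrite f5 ?C4.
have m5n : m5 0 0 = n by have [[mn _ _] _ _] := t4; rewrite f5.
have [||c [-> le1 le2]] := den_select m5n.
- by move=> j; rewrite f5 // f4 // f3 // f2 // z1.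
- by move=> j; rewrite f5 // f4 // f3 // f2 // z1.
split; first  exact (scattered_class sym_e bip C5 G5 c).
exact (OPT_bound even_d sym_e bip C5 G5 le1 le2).
Qed.

(** The word has n^2 + 2 entries of at least one bit each, so time polynomial in n is polynomial in
    the input size. *)
Lemma leq_bitsize_encode n d (e : rel 'I_n) : n <= bitsize (encode e d).
Proof.
apply: leq_trans (_ : size (encode e d) <= _).
  rewrite /encode /= size_allpairs !size_enum_ord.
  by case: n {e} => // n; rewrite mulSn; lia.
by rewrite /bitsize -sum1_size; apply: leq_sum.
Qed.

Local Open Scope ring_scope.

Theorem theorem5 (R : rcfType) :
  exists (c : cmd) (p : {poly nat}),
    forall (d n : nat) (e : rel 'I_n) (A B : {set 'I_n}),
      ~~ odd d -> simple_graph e -> bipartition e A B ->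
      exists (t : nat) (m : store),
        [/\ exec c (init (encode e d)) t m,
            (t <= p.[bitsize (encode e d)])%N,
            scattered e d (output n m) &
            (OPT e d)%:R / (2%:R * Num.sqrt n%:R) <= #|output n m|%:R :> R].
Proof.
exists (compile p_main), (cost p_main) => d n e A B even_d [sym_e _] bip.
have [sc opt] := den_main even_d sym_e bip.
have [t Et let_] := compile_exec (m := init (encode e d)) wf_main (leq_bitsize_encode d e).
exists t, (den p_main (init (encode e d))); split=> //.
move: opt; set k := #|_| => opt.
(* For n = 0 the denominator vanishes, but so does the optimum. *)
have [n0|n_gt0] := posnP n.
  suff -> : OPT e d = 0%N by rewrite mul0r.
  apply/eqP; rewrite -leqn0 -(leq_exp2r _ _ (isT : 0 < 2)%N).
  by apply: leq_trans opt _; rewrite [X in (_ * X * _)%N]n0 muln0.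
have s_gt0 : 0 < Num.sqrt n%:R :> R by rewrite sqrtr_gt0 ltr0n.
rewrite ler_pdivrMr ?mulr_gt0 ?ltr0n //.
(* Squaring removes the root and leaves the inequality over [nat] from [den_main]. *)
rewrite -(@ler_pXn2r _ 2) ?nnegrE ?ler0n ?mulr_ge0 ?ler0n ?(ltW s_gt0) //.
rewrite !exprMn sqr_sqrtr ?ler0n // -!natrX -!natrM ler_nat.
by rewrite mulnC.
Qed.
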